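(* Let $G=G([n],E)$ be a connected comparability graph without proper non-trivial connected modules, with Laplacian $L$, largest Laplacian eigenvalue $\lambda_{\max}$ and eigenspace $\mathcal{E}_{\max}$. Then: (i) every $x\in\mathcal{E}_{\max}\setminus\{0\}$ induces a transitive orientation of $G$ (i.e. $O_x$ orients every edge and is a transitive orientation); (ii) $\dim\mathcal{E}_{\max}=1$; (iii) $G$ has exactly two transitive orientations.
   Context: Graphs are simple undirected on $[n]$; $L_{ii}=\deg i$, $L_{ij}=-1$ if $\{i,j\}\in E$, else $0$. With $N(X)=\{j\notin X:\exists i\in X,\{i,j\}\in E\}$, a module is $A\subseteq[n]$ with $N(i)\setminus A=N(j)\setminus A=N(A)$ for all $i,j\in A$; proper means $A\ne[n]$, non-trivial $|A|>1$, connected $G[A]$ connected. A transitive orientation is an acyclic orientation of all edges such that the comparability graph of its reachability partial order is $G$. For $x\in\mathbb{R}^{[n]}$, $O_x$ sends $\{i,j\}$ to $(i,j)$ if $x_i<x_j$, to $(j,i)$ if $x_i>x_j$, and leaves it unoriented if $x_i=x_j$.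
   Formalization: Claim (iii), that G has exactly two transitive orientations, is stated only for graphs with at least two vertices: the one-vertex graph meets all hypotheses but has exactly one (empty) transitive orientation. *)

(* Defs.v *)
From HB Require Import structures.
From mathcomp Require Import all_boot all_order all_algebra.
From mathcomp Require Import boolp classical_sets reals.

Set Implicit Arguments.
Unset Strict Implicit.
Unset Printing Implicit Defensive.

Import Order.TTheory GRing.Theory Num.Theory.
Local Open Scope ring_scope.

Definition simple_graph (n : nat) (e : rel 'I_n) : Prop :=
  symmetric e /\ irreflexive e.

Definition nbhd (n : nat) (e : rel 'I_n) (X : {set 'I_n}) : {set 'I_n} :=
  [set j | (j \notin X) && [exists i in X, e i j]]%SET.

Definition deg (n : nat) (e : rel 'I_n) (i : 'I_n) : nat := #|nbhd e [set i]%SET|.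

(* The induced subgraph G[A] is connected; the empty graph is not. *)
Definition connected_on (n : nat) (e : rel 'I_n) (A : {set 'I_n}) : Prop :=
  A <> finset.set0 /\
  forall i j : 'I_n, i \in A -> j \in A ->
    connect [rel u v | [&& u \in A, v \in A & e u v]] i j.

Definition connected_graph (n : nat) (e : rel 'I_n) : Prop :=
  connected_on e [set: 'I_n]%SET.

Definition is_module (n : nat) (e : rel 'I_n) (A : {set 'I_n}) : Prop :=
  forall i j : 'I_n, i \in A -> j \in A ->
    nbhd e [set i]%SET :\: A = nbhd e [set j]%SET :\: A /\
    nbhd e [set j]%SET :\: A = nbhd e A.

Definition comparable_in (n : nat) (r : rel 'I_n) : rel 'I_n :=
  fun i j => (i != j) && (r i j || r j i).

Definition comparability_graph (n : nat) (e : rel 'I_n) : Prop :=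
  exists r : rel 'I_n,
    [/\ reflexive r, antisymmetric r, transitive r & e =2 comparable_in r].

(* A set of arcs, possibly leaving some edges unoriented. *)
Definition arcs (n : nat) : Type := {set 'I_n * 'I_n}.

Definition arc_rel (n : nat) (O : arcs n) : rel 'I_n := fun i j => (i, j) \in O.

Definition orients_all_edges (n : nat) (e : rel 'I_n) (O : arcs n) : Prop :=
  (forall i j : 'I_n, (i, j) \in O -> e i j) /\
  (forall i j : 'I_n, e i j -> ((i, j) \in O) (+) ((j, i) \in O)).

Definition acyclic_arcs (n : nat) (O : arcs n) : Prop :=
  forall c : seq 'I_n, cycle (arc_rel O) c -> c = [::].

Definition transitive_orientation (n : nat) (e : rel 'I_n) (O : arcs n) : Prop :=
  [/\ orients_all_edges e O,
      acyclic_arcs O &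
      e =2 comparable_in (connect (arc_rel O))].

Definition induced_arcs (R : realType) (n : nat) (e : rel 'I_n) (x : 'rV[R]_n) :
    arcs n :=
  [set p : 'I_n * 'I_n | e p.1 p.2 && (x 0 p.1 < x 0 p.2)]%SET.

Definition laplacian (R : realType) (n : nat) (e : rel 'I_n) : 'M[R]_n :=
  \matrix_(i, j) if i == j then (deg e i)%:R else if e i j then -1 else 0.

(* Meaningful only for matrices with a real eigenvalue (e.g. symmetric of size
   n > 0): the set is then finite and nonempty, and its sup is its maximum. *)
Definition lambda_max (R : realType) (n : nat) (M : 'M[R]_n) : R :=
  sup [set a : R | eigenvalue M a]%classic.

(* [eigenspace] collects row vectors x with x *m M = a *: x, which for the
   symmetric matrix M = L is the usual eigenspace. *)
Definition Emax (R : realType) (n : nat) (e : rel 'I_n) : 'M[R]_n :=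
  eigenspace (laplacian R e) (lambda_max (laplacian R e)).

(* Main.v *)
Require Import Defs.
From HB Require Import structures.
From mathcomp Require Import all_boot all_order all_algebra.
From mathcomp Require Import boolp classical_sets reals.
From mathcomp Require Import topology normedtype derive.
From mathcomp Require Import ring lra.

(* Fix a transitive orientation s and record a vertex function x by its
   differences x_j - x_i along the arcs (i, j) of s. Transitivity of s makes the
   Laplacian act on these differences through a symmetric nonnegative matrix
   whose off-diagonal support is Gallai's forcing relation: two edges ab, ac
   force each other when b and c are not adjacent. The vertices met by a forcing
   class form a connected module, hence are all the vertices, and then triangles
   are monochromatic, so there is only one forcing class. The matrix is thus
   irreducible, and by Perron-Frobenius its top eigenvalue is simple, with an
   eigenvector p > 0; the divergence of p is an eigenvector of L that increases
   along s and spans E_max. Any other transitive orientation s' has in the same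
   way an s'-increasing vector in this line, so s' is s or its reverse. *)

Set Implicit Arguments.
Unset Strict Implicit.
Unset Printing Implicit Defensive.

Import Order.TTheory GRing.Theory Num.Theory.
Import numFieldNormedType.Exports.
Local Open Scope ring_scope.

(** * Gallai's forcing classes of edges and connected modules *)

Lemma connect_preserved (T : finType) (r : rel T) (P : T -> Prop) (x y : T) :
  (forall a b, r a b -> P a -> P b) -> connect r x y -> P x -> P y.
Proof.
move=> rP /connectP[p + ->]; elim: p x => //= a p IHp x /andP[rxa ap] Px.
exact: IHp ap (rP _ _ rxa Px).
Qed.

(** Edges are ordered pairs: the first disjunct is forcing at the common first vertex, and the swap
    in the second makes forcing at the other end available too. *)
Definition edge_step (n : nat) (e : rel 'I_n) : rel ('I_n * 'I_n) := fun a b =>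
  [&& e a.1 a.2, e b.1 b.2 &
      ((a.1 == b.1) && ~~ e a.2 b.2) || (b == (a.2, a.1))].

Definition edge_class_span (n : nat) (e : rel 'I_n) (a : 'I_n * 'I_n) :
    {set 'I_n} := [set v | [exists w, connect (edge_step e) a (v, w)]]%SET.

Section EdgeClasses.
Variables (n : nat) (e : rel 'I_n).
Hypotheses (simple_e : simple_graph e) (connected_e : connected_graph e).

Let esym : symmetric e := simple_e.1.
Let eirr : irreflexive e := simple_e.2.
Notation step := (edge_step e).
Notation span := (edge_class_span e).

Lemma edge_step_sym : symmetric step.
Proof.
move=> [i j] [k l]; rewrite /edge_step /= !xpair_eqE andbCA [i == k]eq_sym.
by rewrite [e j l]esym [k == j]eq_sym [l == i]eq_sym [(i == l) && _]andbC.
Qed.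

Lemma connect_edge_step_sym (a b : 'I_n * 'I_n) :
  connect step a b = connect step b a.
Proof. exact/sym_connect_sym/edge_step_sym. Qed.

Lemma edge_step_swap (i j : 'I_n) : e i j -> step (i, j) (j, i).
Proof. by move=> eij; rewrite /edge_step /= eij esym eij eqxx orbT. Qed.

Lemma edge_step_fork (i j k : 'I_n) :
  e i j -> e i k -> ~~ e j k -> step (i, j) (i, k).
Proof. by move=> ij ik jk; rewrite /edge_step /= ij ik eqxx jk. Qed.

Lemma connect_edge (a b : 'I_n * 'I_n) :
  connect step a b -> e a.1 a.2 -> e b.1 b.2.
Proof.
apply: (@connect_preserved _ _ (fun p : 'I_n * 'I_n => e p.1 p.2)).
by move=> {}a {}b /and3P[].
Qed.

Lemma span_swap (a : 'I_n * 'I_n) (i j : 'I_n) : e a.1 a.2 ->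
  connect step a (i, j) -> (i \in span a) && (j \in span a).
Proof.
move=> ea aij; rewrite !inE; apply/andP.
split; apply/existsP; first by exists j.
exists i; apply: (connect_trans aij (connect1 _)).
by exact/edge_step_swap/(connect_edge aij ea).
Qed.

(** If v saw only one end x of a class edge xy, the fork at x would put xv in the class and v in the
    span. So adjacency to v passes from end to end and along the whole class. *)
Lemma span_joined (a : 'I_n * 'I_n) (v u1 u2 : 'I_n) : e a.1 a.2 ->
  v \notin span a -> u1 \in span a -> u2 \in span a -> e v u1 -> e v u2.
Proof.
move=> ea vA; rewrite !inE => /existsP[w1 c1] /existsP[w2 c2] vu1.
have vstep x y : connect step a (x, y) -> e v x -> e v y.
  move=> cxy vx; apply/negPn/negP => nvy; case/negP: vA.
  have exy := connect_edge cxy ea.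
  suff cxv : connect step a (x, v) by case/andP: (span_swap ea cxv).
  apply: (connect_trans cxy (connect1 _)).
  by apply: edge_step_fork => //; rewrite 1?esym // esym.
suff [] : connect step a (u2, w2) /\ e v u2 /\ e v w2 by move=> _ [].
have c12 : connect step (u1, w1) (u2, w2).
  by apply: (connect_trans _ c2); rewrite connect_edge_step_sym.
pose P (p : 'I_n * 'I_n) := connect step a p /\ e v p.1 /\ e v p.2.
apply: (@connect_preserved _ _ P _ _ _ c12); last first.
  by split=> //; split=> //; apply: vstep c1 vu1.
move=> [i j] [k l] st [cij [vi vj]].
have ckl : connect step a (k, l) by apply: (connect_trans cij (connect1 st)).
split=> //; case/and3P: st => /= _ _ /orP[/andP[/eqP ik _]|].
  by subst k; split=> //; apply: vstep ckl vi.
by rewrite xpair_eqE => /andP[/eqP-> /eqP->].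
Qed.

Lemma span_module (a : 'I_n * 'I_n) : e a.1 a.2 -> is_module e (span a).
Proof.
move=> ea; have nbE i : i \in span a ->
    (nbhd e [set i] :\: span a = nbhd e (span a))%SET.
  move=> iA; apply/setP => v.
  rewrite !finset.in_setD /nbhd [in LHS]finset.in_set [in RHS]finset.in_set.
  case vA: (v \in span a) => //=; rewrite finset.in_set1.
  have vi : v != i by apply: contraFneq vA => ->.
  rewrite vi /=; apply/existsP/existsP => -[u /andP[uA uv]].
    by exists i; rewrite iA; move: uA uv; rewrite finset.in_set1 => /eqP->.
  exists i; rewrite finset.in_set1 eqxx /= esym.
  by apply: (span_joined ea _ uA iA); rewrite ?vA // esym.
by move=> i j iA jA; rewrite !nbE.
Qed.

(** Consecutive edges of a class share their first vertex or are swaps of each other, so a chain of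
    forcings traces a walk along class edges, which all lie inside the span. *)
Lemma span_connected (a : 'I_n * 'I_n) :
  e a.1 a.2 -> connected_on e (span a).
Proof.
case: a => a0 a1 /= ea; set A := span _.
have aA : a0 \in A by case/andP: (span_swap (a := (a0, a1)) ea (connect0 _ _)).
split; first by move=> A0; move: aA; rewrite A0 finset.in_set0.
set r := (X in connect X); have rsym : symmetric r.
  by move=> u v; rewrite /r /= esym andbCA.
have to_a0 i : i \in A -> connect r a0 i.
  rewrite inE => /existsP[w ciw].
  pose P (p : 'I_n * 'I_n) := connect step (a0, a1) p /\ connect r a0 p.1.
  suff [] : P (i, w) by [].
  apply: (@connect_preserved _ _ P _ _ _ ciw); last by split; exact: connect0.
  move=> [x y] [z t] st [cxy rx]; have czt := connect_trans cxy (connect1 st).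
  split=> //; case/and3P: st => /= exy _ /orP[/andP[/eqP <- _]//|].
  rewrite xpair_eqE => /andP[/eqP-> _].
  apply: (connect_trans rx (connect1 _)).
  by case/andP: (span_swap (a := (a0, a1)) ea cxy) => xA yA; rewrite /r /= xA yA.
move=> i j iA jA; apply: (connect_trans _ (to_a0 _ jA)).
by rewrite (sym_connect_sym rsym) to_a0.
Qed.

Hypothesis no_module : ~ exists A : {set 'I_n},
  [/\ is_module e A, A <> [set: 'I_n]%SET, (1 < #|A|)%N & connected_on e A].

Lemma span_full (a : 'I_n * 'I_n) (v : 'I_n) : e a.1 a.2 -> v \in span a.
Proof.
move=> ea; have [->|/eqP nT] := eqVneq (span a) [set: 'I_n]%SET; first by rewrite inE.
case: no_module; exists (span a); split=> //; first exact: span_module.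
  have /andP[a1A a2A] : (a.1 \in span a) && (a.2 \in span a).
    by apply: span_swap => //; rewrite -surjective_pairing connect0.
  apply/card_gt1P; exists a.1, a.2; split=> //.
  by apply: contraTneq ea => ->; rewrite eirr.
exact: span_connected.
Qed.

(* If both other edges avoided the class of bc, every edge of that class would
   form such a triangle with a, so a would lie outside the span of the class. *)
Lemma triangle_class (a b c : 'I_n) : e b c -> e a b -> e a c ->
  connect step (b, c) (a, b) || connect step (b, c) (a, c).
Proof.
move=> bc ab ac; apply/negPn/negP; rewrite negb_or => /andP[nab nac].
have := @span_full (b, c) a bc; rewrite inE => /existsP[w caw].
pose P (p : 'I_n * 'I_n) := [/\ connect step (b, c) p, e a p.1, e a p.2,
  ~~ connect step (b, c) (a, p.1) & ~~ connect step (b, c) (a, p.2)].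
suff [_] : P (a, w) by rewrite eirr.
apply: (@connect_preserved _ _ P _ _ _ caw) => // -[i j] [k l] st.
case=> /= cij ai aj nai naj.
have ckl := connect_trans cij (connect1 st).
case/and3P: st => /= eij ekl /orP[/andP[/eqP ik njl]|]; last first.
  by rewrite xpair_eqE => /andP[/eqP kj /eqP li]; subst k l.
(* Otherwise the edges from [i] to [l] and to [a] force each other, which puts the side [a i] in the
   class. *)
subst k; have al : e a l.
  apply/negPn/negP => nal; case/negP: nai.
  have ia : e i a by rewrite esym.
  apply: (connect_trans ckl (connect_trans (connect1 _) _)); last first.
    exact/connect1/(edge_step_swap ia).
  by apply: edge_step_fork => //; rewrite esym.
split=> //; apply: contra naj => cal; apply: (connect_trans cal (connect1 _)).
by apply: edge_step_fork => //; rewrite esym.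
Qed.

(** In a triangle, [triangle_class] puts each side in the class of another side, and a partition of
    three sides without singletons has one block. *)
Lemma adjacent_edges_connect (a b c : 'I_n) :
  e a b -> e a c -> connect step (a, b) (a, c).
Proof.
move=> ab ac; have [bc|nbc] := boolP (e b c); last first.
  exact/connect1/edge_step_fork.
have sw i j : e i j -> connect step (i, j) (j, i).
  by move=> ?; exact/connect1/edge_step_swap.
have ba : e b a by rewrite esym.
have ca : e c a by rewrite esym.
have cb : e c b by rewrite esym.
have cs x y : connect step x y -> connect step y x.
  by rewrite connect_edge_step_sym.
case/orP: (triangle_class bc ab ac) => H1.
  case/orP: (triangle_class ab ca cb) => H2.
    exact: connect_trans H2 (sw _ _ ca).
  by have := triangle_class ac ba bc; case/orP=> H;
    apply: cs; [apply: (connect_trans H (sw _ _ ba))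
               |apply: (connect_trans H H1)].
case/orP: (triangle_class ab ca cb) => H2.
  exact: connect_trans H2 (sw _ _ ca).
exact: connect_trans H2 (connect_trans (sw _ _ cb) H1).
Qed.

Lemma edges_connect (a b : 'I_n * 'I_n) :
  e a.1 a.2 -> e b.1 b.2 -> connect step a b.
Proof.
case: a b => [i j] [k l] /= ij.
case: connected_e => _ /(_ i k (finset.in_setT _) (finset.in_setT _)).
move: k l; suff H k : connect [rel u v | [&& u \in [set: 'I_n]%SET,
    v \in [set: 'I_n]%SET & e u v]] i k ->
    forall l, e k l -> connect step (i, j) (k, l).
  by move=> k l /H; apply.
move=> ck; pose P k := forall l, e k l -> connect step (i, j) (k, l).
apply: (@connect_preserved _ _ P _ _ _ ck) => [u v /and3P[_ _ uv] Pu l vl|l il].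
  have vu : e v u by rewrite esym.
  apply: (connect_trans (Pu _ uv) (connect_trans (connect1 (edge_step_swap uv)) _)).
  exact: adjacent_edges_connect.
exact: adjacent_edges_connect.
Qed.

End EdgeClasses.

(** * Transitive orientations as strict orders *)

Definition orders_edges (n : nat) (e s : rel 'I_n) : Prop :=
  [/\ irreflexive s, transitive s & forall i j, e i j = s i j || s j i].

Section Orientations.
Variables (n : nat) (e : rel 'I_n).

Lemma orders_edges_asym (s : rel 'I_n) (i j : 'I_n) :
  orders_edges e s -> s i j -> s j i = false.
Proof.
move=> [irr tr _] ij; apply/negP => ji.
by have := tr _ _ _ ij ji; rewrite irr.
Qed.

Lemma orders_edges_rev (s : rel 'I_n) :
  orders_edges e s -> orders_edges e (fun i j => s j i).
Proof.
case=> irr tr sE; split=> // [j i k ij jk|i j]; first exact: tr jk ij.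
by rewrite sE orbC.
Qed.

(** From arcs i to j to k, reachability makes i and k adjacent unless equal; excluding cycles of
    length 2 and 3 leaves only the arc from i to k. Conversely, reachability along a transitive
    relation is equality or a single arc, so a cycle would yield a loop. *)
Lemma transitive_orientationP (O : arcs n) : irreflexive e ->
  transitive_orientation e O <-> orders_edges e (arc_rel O).
Proof.
move=> eirr; split=> [[[Oe eO] acyc eE]|sO].
  have OE i j : e i j = arc_rel O i j || arc_rel O j i.
    apply/idP/orP => [/eO|[/Oe//|/Oe ji]].
      by rewrite /arc_rel; case: ((i, j) \in O) => /= [_|->]; [left|right].
    by move: (ji); rewrite !eE /comparable_in eq_sym orbC.
  split=> // [i|j i k ij jk].
    by apply/negP => /Oe; rewrite eirr.
  have nik : i != k.
    apply/negP => /eqP ik; subst k.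
    by have := acyc [:: i; j]; rewrite /= ij jk => /(_ isT).
  have : e i k.
    rewrite eE /comparable_in nik /=; apply/orP; left.
    exact: connect_trans (connect1 ij) (connect1 jk).
  rewrite OE => /orP[//|ki].
  by have := acyc [:: i; j; k]; rewrite /= ij jk ki => /(_ isT).
have [irr tr sE] := sO.
have cE i j : connect (arc_rel O) i j -> i = j \/ arc_rel O i j.
  move=> cij; pose P k := i = k \/ arc_rel O i k.
  apply: (@connect_preserved _ _ P _ _ _ cij); last by left.
  by move=> u v uv [iu|iu]; right; [rewrite iu|exact: tr iu uv].
split.
- split=> i j; first by rewrite sE /arc_rel => ->.
  rewrite sE; case ij: (arc_rel O i j) => /=.
    by have := orders_edges_asym sO ij; rewrite /arc_rel in ij *; rewrite ij => ->.
  by rewrite /arc_rel in ij *; rewrite ij.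
- case=> // x c; rewrite /= rcons_path => /andP[xc lx].
  have cl : connect (arc_rel O) x (last x c) by apply/connectP; exists c.
  have [xl|xl] := cE _ _ cl; first by move: lx; rewrite -xl irr.
  by have := tr _ _ _ xl lx; rewrite irr.
move=> i j; rewrite sE /comparable_in; apply/orP/andP.
  case=> ij; (split; [by apply: contraTneq ij => ->; rewrite irr|]);
  by rewrite (connect1 ij) ?orbT.
case=> nij /orP[] /cE[ij|]; [|by left| |by right];
by rewrite ij eqxx in nij.
Qed.

Lemma comparability_orders_edges :
  comparability_graph e -> exists s, orders_edges e s.
Proof.
case=> r [rr ra rt eE]; exists (fun i j => (i != j) && r i j); split.
- by move=> i; rewrite eqxx.
- move=> j i k /andP[nij ij] /andP[njk jk]; rewrite (rt _ _ _ ij jk) andbT.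
  apply: contra nij => /eqP ik; subst k; apply/eqP/ra; exact/andP.
- by move=> i j; rewrite eE /comparable_in [j == i]eq_sym -andb_orr.
Qed.

(* Forcing never reverses the orientation s, so connectedness of the edges under
   [edge_step] passes to the arcs of s. *)
Lemma arcs_forced (s : rel 'I_n) (P : 'I_n * 'I_n -> Prop) :
  simple_graph e -> connected_graph e ->
  (~ exists A : {set 'I_n},
     [/\ is_module e A, A <> [set: 'I_n]%SET, (1 < #|A|)%N & connected_on e A]) ->
  orders_edges e s ->
  (forall i j k, s i j -> s i k -> ~~ e j k -> P (i, j) -> P (i, k)) ->
  (forall i j k, s j i -> s k i -> ~~ e j k -> P (j, i) -> P (k, i)) ->
  forall a b, s a.1 a.2 -> s b.1 b.2 -> P a -> P b.
Proof.
move=> simp conn nomod sO Pout Pin a b sa sb Pa.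
have [irr tr sE] := sO.
(* Since [edge_step] may swap a pair, [Q] reads an edge through whichever of its two orders is an
   arc of [s]. *)
pose Q (p : 'I_n * 'I_n) :=
  (s p.1 p.2 -> P p) /\ (s p.2 p.1 -> P (p.2, p.1)).
have [] : Q b; last by move=> /(_ sb).
have cab : connect (edge_step e) a b.
  by apply: edges_connect => //; rewrite sE ?sa ?sb.
apply: (@connect_preserved _ _ Q _ _ _ cab); last first.
  by split=> // sa'; rewrite (orders_edges_asym sO sa) in sa'.
move=> [i j] [k l] /and3P[/= ij kl /orP[/andP[/eqP ik njl]|]]; last first.
  by rewrite xpair_eqE => /andP[/eqP-> /eqP->] [].
subst k => -[/= H1 H2]; move: njl (njl); rewrite {1}sE negb_or => /andP[njl nlj] nejl.
(* An arc into [i] followed by an arc out of [i] would join the nonadjacent [j] and [l], so both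
   edges leave [i] or both enter it. *)
rewrite sE in ij; split=> sil.
  case/orP: ij => ij; first by apply: Pout ij sil nejl (H1 ij).
  by case/negP: njl; exact: tr ij sil.
case/orP: ij => ij; last by apply: Pin ij sil nejl (H2 ij).
by case/negP: nlj; exact: tr sil ij.
Qed.

End Orientations.

(** * Perron-Frobenius theory for a symmetric nonnegative kernel *)

Section Perron.
Variables (R : realType) (T : finType) (K : T -> T -> R).

Definition quad_form (y : T -> R) : R := \sum_a \sum_b K a b * y a * y b.

Definition norm_sq (y : T -> R) : R := \sum_a y a ^+ 2.

(** A continuous form attains its maximum on the compact unit sphere, and homogeneity extends the
    bound to every v. Functions on [T] are encoded as row vectors to use their topology; [t] makes
    the sphere nonempty. *)
Lemma rayleigh_max (t : T) :
  exists y, norm_sq y = 1 /\ forall v, quad_form v <= quad_form y * norm_sq v.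
Proof.
pose f (u : 'rV[R]_#|T|) a : R := u 0 (enum_rank a).
pose toV (v : T -> R) : 'rV[R]_#|T| := \row_i v (enum_val i).
have fV v : f (toV v) = v by apply/funext => a; rewrite /f mxE enum_rankK.
have cf a : continuous (fun u : 'rV[R]_#|T| => f u a) by move=> u; exact: coord_continuous.
have csum (F : T -> 'rV[R]_#|T| -> R) :
    (forall a, continuous (F a)) -> continuous (fun u : 'rV[R]_#|T| => \sum_a F a u).
  by move=> cF; apply: (continuous_big add_continuous) => a _; exact: cF.
have cN : continuous (fun u : 'rV[R]_#|T| => norm_sq (f u)).
  by apply: (csum) => a u; exact: (cvgM (cf a u) (cf a u)).
have cQ : continuous (fun u : 'rV[R]_#|T| => quad_form (f u)).
  apply: (csum) => a; apply: (csum) => b u.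
  exact: (cvgM (cvgM (cvg_cst (K a b)) (cf a u)) (cf b u)).
pose S := [set u : 'rV[R]_#|T| | norm_sq (f u) = 1]%classic.
have [] := @EVT_max_rV R _ (fun u => quad_form (f u)) S.
- exists (toV (fun a => (a == t)%:R)); rewrite /S /= fV /norm_sq (bigD1 t) //=.
  rewrite eqxx expr1n big1 ?addr0 // => a /negPf->.
  by rewrite expr0n.
- apply: bounded_closed_compact.
    (* The norm of a row vector is its largest absolute entry, and one squared entry is at most
       [norm_sq]. *)
    exists 1; split=> // M M1 u /= Su; rewrite [`|_|]mx_normrE.
    apply: bigmax_le; first exact: ltW (lt_trans ltr01 M1).
    move=> [i j] _ /=; apply: ltW; apply: le_lt_trans M1.
    rewrite -(@ler_pXn2r _ 2) ?nnegrE // expr1n real_normK ?num_real //.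
    rewrite -Su /norm_sq (bigD1 (enum_val j)) //= /f enum_valK ord1 lerDl.
    by apply: sumr_ge0 => a _; exact: sqr_ge0.
  apply: (@preimage_closed _ _ (fun u : 'rV[R]_#|T| => norm_sq (f u))
    [set x | x = 1]%classic).
    by move=> u _; exact: cN.
  exact: closed_eq.
- by apply: continuous_subspaceT => u; exact: cQ.
move=> c; rewrite inE => Sc cmax; exists (f c); split=> // v.
have [v0|v0] := eqVneq (norm_sq v) 0.
  have z a : v a = 0.
    have := psumr_eq0P (fun a _ => sqr_ge0 (v a)) v0 (i := a) isT.
    by move/eqP; rewrite sqrf_eq0 => /eqP.
  rewrite v0 mulr0 /quad_form big1 // => a _; rewrite big1 // => b _.
  by rewrite z mulr0 mul0r.
have vp : 0 < norm_sq v by rewrite lt_def v0 sumr_ge0 // => a _; exact: sqr_ge0.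
pose k := (Num.sqrt (norm_sq v))^-1.
have k2 : k ^+ 2 = (norm_sq v)^-1 by rewrite exprVn sqr_sqrtr // ltW.
have := cmax (toV (fun a => k * v a)); rewrite fV inE /S /= fV.
have -> : norm_sq (fun a => k * v a) = 1.
  rewrite /norm_sq; under eq_bigr do rewrite exprMn.
  by rewrite -mulr_sumr k2 mulVf.
have -> : quad_form (fun a => k * v a) = k ^+ 2 * quad_form v.
  rewrite /quad_form mulr_sumr; apply: eq_bigr => a _.
  by rewrite mulr_sumr; apply: eq_bigr => b _; ring.
by move=> /(_ erefl); rewrite k2 mulrC ler_pdivrMr.
Qed.

Definition eigenfun (mu : R) (y : T -> R) : Prop :=
  forall a, \sum_b K a b * y b = mu * y a.

Hypothesis K_sym : forall a b, K a b = K b a.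

(* The form mu |v|^2 - Q v is nonnegative and vanishes at y, so its
   linearization at y vanishes as well. *)
Lemma rayleigh_max_eigenfun (mu : R) (y : T -> R) :
  (forall v, quad_form v <= mu * norm_sq v) -> quad_form y = mu * norm_sq y ->
  eigenfun mu y.
Proof.
move=> Qle Qy a; pose d := mu * y a - \sum_b K a b * y b.
suff : d = 0 by move/eqP; rewrite subr_eq0 => /eqP.
pose v t b := y b + t * (b == a)%:R.
have sumd (F : T -> R) : \sum_b F b * (b == a)%:R = F a.
  rewrite (bigD1 a) //= eqxx mulr1 big1 ?addr0 // => b /negPf->.
  by rewrite mulr0.
have Nv t : norm_sq (v t) = norm_sq y + t * (2 * y a) + t ^+ 2.
  rewrite /norm_sq (eq_bigr (fun b => y b ^+ 2 +
    (t * (2 * y b) + t ^+ 2 * (b == a)%:R) * (b == a)%:R)).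
    by rewrite big_split /= sumd eqxx mulr1 addrA.
  by move=> b _; rewrite /v; ring.
have Qv t : quad_form (v t) =
    quad_form y + t * (2 * \sum_b K a b * y b) + t ^+ 2 * K a a.
  rewrite /quad_form.
  rewrite (eq_bigr (fun b => (\sum_c K b c * y b * y c + t * (K b a * y b)) +
    (t * (\sum_c K b c * y c) + t ^+ 2 * K b a) * (b == a)%:R)); last first.
    move=> b _; rewrite (eq_bigr (fun c => (K b c * y b * y c +
      (b == a)%:R * (t * (K b c * y c))) + ((t * K b c * y b) +
      t ^+ 2 * K b c * (b == a)%:R) * (c == a)%:R)); last first.
      by move=> c _; rewrite /v; ring.
    by rewrite !big_split /= sumd -!mulr_sumr; ring.
  rewrite !big_split /= sumd -mulr_sumr.
  under [X in _ + t * X + _]eq_bigr do rewrite K_sym.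
  by ring.
have key t : 0 <= t * (2 * d) + t ^+ 2 * (mu - K a a).
  by have := Qle (v t); rewrite Nv Qv Qy /d; lra.
set m := mu - K a a in key.
have [//|d0] := eqVneq d 0.
(* A step against the sign of [d]: at t = -d/q the expression in [key] is (d/q)^2 (m - 2q), negative
   because q exceeds |m|. *)
pose q := 1 + `|m|; have q0 : 0 < q by rewrite ltr_pwDl.
have := key (- d / q).
have -> : - d / q * (2 * d) + (- d / q) ^+ 2 * m =
    (d / q) ^+ 2 * (m - 2 * q) by field; rewrite gt_eqF.
rewrite pmulr_rge0; last by rewrite exprn_even_gt0 //= mulf_neq0 // invr_neq0 // gt_eqF.
by have := ler_norm m; have := normr_ge0 m; rewrite /q; lra.
Qed.

Hypothesis K_ge0 : forall a b, 0 <= K a b.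
(** By symmetry [K_supp] confines K to pairs in [O]. [K_irr] is irreducibility on [O], phrased as
    induction along positive entries. *)
Variable O : pred T.
Hypothesis K_supp : forall a b, 0 < K a b -> O b.
Hypothesis K_diag : forall a, O a -> 0 < K a a.
Hypothesis K_irr : forall P : T -> Prop,
  (forall a b, 0 < K a b -> P a -> P b) -> forall a b, O a -> O b -> P a -> P b.

(** If y a > 0 and K a b > 0, then mu * y b is a sum of nonnegative terms containing K b a * y a >
    0; irreducibility spreads this positivity over [O]. *)
Lemma eigenfun_pos (mu : R) (y : T -> R) : 0 < mu -> eigenfun mu y ->
  (forall a, 0 <= y a) -> (exists2 a, O a & y a != 0) ->
  forall b, O b -> 0 < y b.
Proof.
move=> mu0 Ey y0 [a Oa ya] b Ob.
apply: (K_irr (P := fun a => 0 < y a)) Oa Ob _; last by rewrite lt_def ya y0.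
move=> {ya}{}a {}b Kab ya; rewrite -(pmulr_rgt0 _ mu0) -Ey (bigD1 a) //=.
rewrite ltr_pwDl ?mulr_gt0 //; first by rewrite K_sym.
by apply: sumr_ge0 => c _; rewrite mulr_ge0.
Qed.

Lemma eigenfun_supp (mu : R) (y : T -> R) a :
  mu != 0 -> eigenfun mu y -> ~~ O a -> y a = 0.
Proof.
move=> mu0 Ey nOa; apply: (mulfI mu0); rewrite -Ey mulr0 big1 // => b _.
have [->|Kab] := eqVneq (K a b) 0; first by rewrite mul0r.
by case/negP: nOa; apply: (@K_supp b); rewrite K_sym lt_def Kab K_ge0.
Qed.

(** As K is nonnegative, replacing a Rayleigh maximiser y by |y| does not lower the form, so |y| is
    a maximiser and an eigenfunction. Testing the indicator of [a0] gives mu > 0 from the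
    diagonal. *)
Lemma perron_exists (a0 : T) : O a0 ->
  exists mu p, [/\ 0 < mu, eigenfun mu p & forall a, O a -> 0 < p a].
Proof.
move=> Oa0; have [y [y1 ymax]] := rayleigh_max a0; set mu := quad_form y in ymax.
have mu0 : 0 < mu.
  have := ymax (fun a => (a == a0)%:R).
  have -> : norm_sq (fun a => (a == a0)%:R) = 1.
    rewrite /norm_sq (bigD1 a0) //= eqxx expr1n big1 ?addr0 // => a /negPf->.
    by rewrite expr0n.
  rewrite mulr1 /quad_form (bigD1 a0) //= (bigD1 a0) //= eqxx !mulr1.
  move: (K_diag Oa0) => Kp H; apply: lt_le_trans Kp (le_trans _ H).
  rewrite -addrA lerDl addr_ge0 //; first by apply: sumr_ge0 => b _; rewrite !mulr_ge0.
  by apply: sumr_ge0 => b _; apply: sumr_ge0 => c _; rewrite !mulr_ge0.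
pose p a := `|y a|.
have Np : norm_sq p = norm_sq y.
  by apply: eq_bigr => a _; rewrite real_normK ?num_real.
have Ep : eigenfun mu p.
  apply: rayleigh_max_eigenfun => //; apply/le_anti/andP; split; first exact: ymax.
  rewrite Np y1 mulr1; apply: ler_sum => a _; apply: ler_sum => b _.
  by rewrite -!mulrA ler_wpM2l // -normrM ler_norm.
exists mu, p; split=> //; apply: (eigenfun_pos mu0 Ep).
  by move=> a; exact: normr_ge0.
have [a ya] : exists a, y a != 0.
  apply: contrapT => /forallNP y0; move: y1; rewrite /norm_sq big1.
    by move/eqP; rewrite eq_sym oner_eq0.
  by move=> a _; have /negP/negPn/eqP-> := y0 a; rewrite expr0n.
exists a; last by rewrite normr_eq0.
apply: contraNT ya => nOa; rewrite -normr_eq0 -/(p a).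
by rewrite (eigenfun_supp _ Ep nOa) ?eqxx // gt_eqF.
Qed.

Variables (mu : R) (p : T -> R).
Hypotheses (mu0 : 0 < mu) (Ep : eigenfun mu p) (p0 : forall a, O a -> 0 < p a).

Lemma perron_ge0 a : 0 <= p a.
Proof.
have [/p0/ltW//|nOa] := boolP (O a).
by rewrite (eigenfun_supp _ Ep nOa) // gt_eqF.
Qed.

(** Pointwise la |z| is at most K |z|; pairing with p and moving K onto p gives la S <= mu S, where
    S > 0. *)
Lemma perron_max (la : R) (z : T -> R) :
  eigenfun la z -> (exists2 a, O a & z a != 0) -> la <= mu.
Proof.
move=> Ez [a0 Oa0 za0]; pose S := \sum_a `|z a| * p a.
have S0 : 0 < S.
  rewrite /S (bigD1 a0) //= ltr_pwDl ?mulr_gt0 ?normr_gt0 ?p0 //.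
  by apply: sumr_ge0 => a _; rewrite mulr_ge0 ?perron_ge0.
have muS : mu * S = \sum_a (\sum_b K a b * `|z b|) * p a.
  rewrite /S mulr_sumr; under [RHS]eq_bigr do rewrite mulr_suml.
  rewrite exchange_big /=; apply: eq_bigr => b _.
  rewrite mulrCA -Ep mulr_sumr; apply: eq_bigr => a _.
  by rewrite K_sym; ring.
rewrite -(ler_pM2r S0) muS /S mulr_sumr.
apply: ler_sum => a _; rewrite mulrA ler_wpM2r ?perron_ge0 //.
apply: le_trans (_ : `|la * z a| <= _).
  by rewrite normrM ler_wpM2r // ler_norm.
rewrite -Ez; apply: le_trans (ler_norm_sum _ _ _) _; apply: ler_sum => b _.
by rewrite normrM ger0_norm.
Qed.

(* Subtract the largest multiple of p that keeps the function nonnegative: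
   the result vanishes at an arc, hence everywhere. *)
Lemma perron_simple (a0 : T) (z : T -> R) :
  O a0 -> eigenfun mu z -> exists c, forall a, z a = c * p a.
Proof.
move=> Oa0 Ez; case: (@arg_minP _ _ _ a0 O (fun a => z a / p a) Oa0) => a Oa amin.
pose c := z a / p a; exists c => b; apply/eqP; rewrite -subr_eq0.
pose y b := z b - c * p b; rewrite -/(y b).
have munz : mu != 0 by rewrite gt_eqF.
have Ey : eigenfun mu y.
  move=> d; rewrite /y; under eq_bigr do rewrite mulrBr mulrCA.
  by rewrite sumrB -mulr_sumr Ez Ep; ring.
have [Ob|nOb] := boolP (O b); last by rewrite (eigenfun_supp _ Ey).
apply: contraT => yb.
have y0 d : 0 <= y d.
  have [Od|nOd] := boolP (O d); last by rewrite (eigenfun_supp _ Ey).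
  by rewrite subr_ge0 -ler_pdivlMr ?p0 //; exact: amin.
have := eigenfun_pos mu0 Ey y0 (ex_intro2 _ _ b Ob yb) Oa.
by rewrite /y /c divfK ?subrr ?ltxx // gt_eqF ?p0.
Qed.

End Perron.

(** * The Laplacian acting on differences along arcs *)

Section ArcKernel.
Variables (R : realType) (n : nat) (e s : rel 'I_n).

Definition lap (x : 'I_n -> R) (j : 'I_n) : R :=
  \sum_k (e j k)%:R * (x j - x k).

Definition grad (x : 'I_n -> R) (a : 'I_n * 'I_n) : R :=
  (s a.1 a.2)%:R * (x a.2 - x a.1).

(** Inflow minus outflow: the sign that makes it adjoint to [grad] on functions supported on
    arcs. *)
Definition divergence (p : 'I_n * 'I_n -> R) (j : 'I_n) : R :=
  \sum_k (p (k, j) - p (j, k)).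

(* Off the diagonal, the 0-1 matrix of the forcing relation on arcs. The first
   two terms contribute 2 on the diagonal, because e is irreflexive. *)
Definition arc_kernel (a b : 'I_n * 'I_n) : R :=
  (s a.1 a.2 && s b.1 b.2)%:R *
  (((b.1 == a.1) && ~~ e a.2 b.2)%:R + ((b.2 == a.2) && ~~ e a.1 b.1)%:R
   + (b == a)%:R * \sum_k (e a.1 k && e a.2 k)%:R).

Hypotheses (simple_e : simple_graph e) (sO : orders_edges e s).

Let esym : symmetric e := simple_e.1.
Let eirr : irreflexive e := simple_e.2.

Lemma arc_kernel_sym a b : arc_kernel a b = arc_kernel b a.
Proof.
rewrite /arc_kernel andbC ![a.1 == b.1]eq_sym ![a.2 == b.2]eq_sym.
rewrite [e a.2 _]esym [e a.1 b.1]esym [a == b]eq_sym.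
by have [->//|] := eqVneq b a; rewrite !mul0r.
Qed.

Lemma arc_kernel_ge0 a b : 0 <= arc_kernel a b.
Proof.
rewrite /arc_kernel mulr_ge0 ?addr_ge0 ?mulr_ge0 ?ler0n //.
by apply: sumr_ge0 => k _; rewrite ler0n.
Qed.

Lemma arc_kernel_gt0 a b : s a.1 a.2 -> s b.1 b.2 ->
  ((b.1 == a.1) && ~~ e a.2 b.2) || ((b.2 == a.2) && ~~ e a.1 b.1) ->
  0 < arc_kernel a b.
Proof.
move=> sa sb ab; rewrite /arc_kernel sa sb mul1r.
apply: (@ltr_wpDr _ _ _ _ _ _); first by rewrite mulr_ge0 ?sumr_ge0.
by case/orP: ab => ->; [rewrite ltr_pwDl|rewrite ltr_wpDl].
Qed.

Lemma arc_kernel_supp a b : 0 < arc_kernel a b -> s b.1 b.2.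
Proof.
by rewrite /arc_kernel; case: (s b.1 _) => //; rewrite andbF mul0r ltxx.
Qed.

Lemma sum_pair1 (F : 'I_n -> R) i :
  \sum_(b : 'I_n * 'I_n) (b.1 == i)%:R * F b.2 = \sum_k F k.
Proof.
rewrite -(pair_bigA _ (fun k l => (k == i)%:R * F l)) /= (bigD1 i) //=.
rewrite [X in _ + X]big1 ?addr0; last first.
  by move=> k /negPf->; rewrite big1 // => l _; rewrite mul0r.
by apply: eq_bigr => k _; rewrite eqxx mul1r.
Qed.

Lemma sum_pair2 (F : 'I_n -> R) j :
  \sum_(b : 'I_n * 'I_n) (b.2 == j)%:R * F b.1 = \sum_k F k.
Proof.
rewrite -(pair_bigA _ (fun k l => (l == j)%:R * F k)) /=.
apply: eq_bigr => k _; rewrite (bigD1 j) //= eqxx mul1r big1 ?addr0 //.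
by move=> l /negPf->; rewrite mul0r.
Qed.

(* This is where transitivity enters: if k is adjacent to j but not to i, then
   i < j forces k < j; if k is adjacent to i but not to j, it forces i < k. *)
Lemma arc_kernel_grad (x : 'I_n -> R) a :
  \sum_b arc_kernel a b * grad x b = grad (lap x) a.
Proof.
have [irr tr sE] := sO; case: a => i j; rewrite /grad /arc_kernel /=.
have [sij|_] := boolP (s i j); last first.
  by rewrite mul0r big1 // => b _; rewrite !mul0r.
(* [F] collects the arcs leaving i, [G] those entering j, and [C] the common neighbours; the sum is
   then matched with lap x j - lap x i one vertex k at a time. *)
pose F k := ((s i k)%:R * (~~ e j k)%:R) * (x k - x i).
pose G k := ((s k j)%:R * (~~ e i k)%:R) * (x j - x k).
pose C := \sum_k (e i k && e j k)%:R * (x j - x i).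
have -> : \sum_(b : 'I_n * 'I_n) (true && s b.1 b.2)%:R *
    (((b.1 == i) && ~~ e j b.2)%:R +
    ((b.2 == j) && ~~ e i b.1)%:R + (b == (i, j))%:R *
    \sum_k (e i k && e j k)%:R) * ((s b.1 b.2)%:R * (x b.2 - x b.1)) =
  \sum_(b : 'I_n * 'I_n) ((b.1 == i)%:R * F b.2 + (b.2 == j)%:R * G b.1 +
    (b == (i, j))%:R * C).
  apply: eq_bigr => -[k l] _ /=; rewrite /F /G /C -mulr_suml xpair_eqE.
  have [->|_] := eqVneq k i; have [->|_] := eqVneq l j;
    rewrite ?sij ?eirr ?[e i j]sE ?[e j i]sE ?sij ?orbT /=; try ring.
  - by case: (s i l); case: (~~ e j l) => /=; ring.
  - by case: (s k j); case: (~~ e i k) => /=; ring.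
rewrite !big_split /= sum_pair1 sum_pair2 [X in _ + X](bigD1 (i, j)) //=.
rewrite eqxx mul1r [X in _ + (C + X)]big1 ?addr0; last first.
  by move=> b /negPf->; rewrite mul0r.
rewrite mul1r /C /lap -sumrB -!big_split /=; apply: eq_bigr => k _.
rewrite /F /G; have [->|ki] := eqVneq k i.
  by rewrite irr !eirr sij esym [e i j]sE sij /=; ring.
case jk: (e j k); case ik: (e i k) => /=; try ring.
- suff -> : s k j by rewrite /=; ring.
  move: jk ik; rewrite !sE => /orP[jk|->//].
  by rewrite (tr _ _ _ sij jk).
- suff -> : s i k by rewrite /=; ring.
  move: jk ik; rewrite !sE => + /orP[->//|ki']; by rewrite (tr _ _ _ ki' sij) orbT.
have -> : s i k = false by move: ik; rewrite sE; case: (s i k).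
have -> : s k j = false by move: jk; rewrite sE orbC; case: (s k j).
by rewrite /=; ring.
Qed.

Lemma lap_sym (x v : 'I_n -> R) : \sum_j v j * lap x j = \sum_j lap v j * x j.
Proof.
rewrite /lap; under eq_bigr do rewrite mulr_sumr.
under [RHS]eq_bigr do rewrite mulr_suml.
apply/eqP; rewrite -subr_eq0 -sumrB; apply/eqP.
under eq_bigr do rewrite -sumrB.
pose H j k := (e j k)%:R * (v k * x j).
rewrite (eq_bigr (fun j => \sum_k (H j k - H k j))); last first.
  by move=> j _; apply: eq_bigr => k _; rewrite /H [e k j]esym; ring.
under eq_bigr do rewrite sumrB.
by rewrite sumrB [X in _ - X]exchange_big subrr.
Qed.

Lemma divergence_adj (v : 'I_n -> R) (p : 'I_n * 'I_n -> R) :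
  (forall a, ~~ s a.1 a.2 -> p a = 0) ->
  \sum_j v j * divergence p j = \sum_a grad v a * p a.
Proof.
move=> p0; rewrite /divergence.
under eq_bigr do rewrite mulr_sumr.
pose P j k := v j * p (j, k); pose Q j k := v k * p (j, k).
rewrite (eq_bigr (fun j => \sum_k (Q k j - P j k))); last first.
  by move=> j _; apply: eq_bigr => k _; rewrite mulrBr.
under eq_bigr do rewrite sumrB.
rewrite sumrB exchange_big -sumrB /=; under eq_bigr do rewrite -sumrB.
rewrite (pair_bigA _ (fun j k => Q j k - P j k)) /=.
apply: eq_bigr => -[j k] _; rewrite /P /Q /grad /=.
by have [_|njk] := boolP (s j k); rewrite ?(p0 (j, k) njk) /=; ring.
Qed.

End ArcKernel.

(** * The top Laplacian eigenvalue, obtained from the arc kernel *)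

Section Spectrum.
Variables (R : realType) (n : nat) (e s : rel 'I_n).
Hypotheses (simple_e : simple_graph e) (connected_e : connected_graph e).
Hypothesis no_module : ~ exists A : {set 'I_n},
  [/\ is_module e A, A <> [set: 'I_n]%SET, (1 < #|A|)%N & connected_on e A].
Hypothesis sO : orders_edges e s.

Lemma connected_constant (z : 'I_n -> R) :
  (forall i j, s i j -> z i = z j) -> forall i j, z i = z j.
Proof.
move=> zs i j; have [irr tr sE] := sO.
have [_ /(_ i j (finset.in_setT _) (finset.in_setT _))] := connected_e.
pose P k := z i = z k; move/(@connect_preserved _ _ P); apply=> // u v.
by rewrite /= !finset.in_setT /= sE /P => /orP[/zs->|/zs->].
Qed.

(** By connectedness z is constant, so [lap] kills it; this handles what [grad] cannot see of an
    eigenfunction. *)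
Lemma grad_eq0_eigen (la : R) (z : 'I_n -> R) :
  (forall a, grad s z a = 0) -> (forall j, lap e z j = la * z j) ->
  forall j, la * z j = 0.
Proof.
move=> gz Lz j; rewrite -Lz /lap big1 // => k _.
rewrite (@connected_constant z _ k j) ?subrr ?mulr0 // => u v suv.
by have := gz (u, v); rewrite /grad /= suv mul1r => /eqP; rewrite subr_eq0 => /eqP.
Qed.

(** Counting predecessors works. Pairing such a function with the divergence of p shows that the
    divergence is nonzero. *)
Lemma increasing_exists :
  exists w : 'I_n -> R, forall i j, s i j -> w i < w j.
Proof.
have [irr tr _] := sO.
exists (fun j => #|[pred k | s k j]|%:R) => i j ij; rewrite ltr_nat.
apply: proper_card; apply/properP; split.
  by apply/fintype.subsetP => k; rewrite !inE => ki; exact: tr ki ij.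
by exists i; rewrite inE // irr.
Qed.

(** [grad] sends eigenfunctions of [lap] to eigenfunctions of the kernel with the same eigenvalue,
    which transfers maximality and simplicity; [divergence] carries p back to the vertices. *)
Lemma laplacian_perron (a0 : 'I_n * 'I_n) : s a0.1 a0.2 ->
  exists mu x, [/\ 0 < mu,
    (forall j, lap e x j = mu * x j),
    (forall i j, s i j -> x i < x j),
    (forall la z, (forall j, lap e z j = la * z j) -> (exists j, z j != 0) ->
       la <= mu) &
    (forall z, (forall j, lap e z j = mu * z j) ->
       exists c : R, forall j, z j = c * x j)].
Proof.
move=> sa0; have [irr tr sE] := sO.
pose K := arc_kernel R e s; pose O (a : 'I_n * 'I_n) := s a.1 a.2.
have Ksym : forall a b, K a b = K b a := arc_kernel_sym R s simple_e.
have K0 : forall a b, 0 <= K a b by exact: arc_kernel_ge0.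
have Ksupp : forall a b, 0 < K a b -> O b by exact: arc_kernel_supp.
have Kdiag a : O a -> 0 < K a a.
  by move=> Oa; apply: arc_kernel_gt0; rewrite // eqxx simple_e.2.
have Kirr (P : 'I_n * 'I_n -> Prop) : (forall a b, 0 < K a b -> P a -> P b) ->
    forall a b, O a -> O b -> P a -> P b.
  move=> KP; apply: (arcs_forced simple_e connected_e no_module sO).
    by move=> i j k ij ik jk; apply: KP; apply: arc_kernel_gt0; rewrite //= eqxx jk.
  by move=> i j k ij ik jk; apply: KP; apply: arc_kernel_gt0; rewrite //= eqxx jk orbT.
have [mu [p [mu0 Ep p0]]] := perron_exists Ksym K0 Ksupp Kdiag Kirr sa0.
have psupp a : ~~ O a -> p a = 0.
  by apply: (eigenfun_supp Ksym K0 Ksupp _ Ep); rewrite gt_eqF.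
have eigen_grad la z : (forall j, lap e z j = la * z j) -> eigenfun K la (grad s z).
  move=> Lz a; rewrite (arc_kernel_grad simple_e sO) /grad !Lz.
  by rewrite -mulrBr mulrCA.
pose x := divergence p.
have adj v : \sum_j v j * x j = \sum_a grad s v a * p a.
  exact: divergence_adj.
(* Tested against the indicator of [j], this is adjointness of [grad] and [divergence] together with
   the symmetry of [lap] and [K]. *)
have Lx j : lap e x j = mu * x j.
  pose v (k : 'I_n) : R := (k == j)%:R.
  have pick (f : 'I_n -> R) : \sum_k v k * f k = f j.
    rewrite (bigD1 j) //= /v eqxx mul1r big1 ?addr0 // => k /negPf->.
    by rewrite mul0r.
  rewrite -(pick (lap e x)) -[x j]pick (lap_sym simple_e) adj (adj v).
  under eq_bigr do rewrite -(arc_kernel_grad simple_e sO) mulr_suml.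
  rewrite exchange_big mulr_sumr /=; apply: eq_bigr => b _.
  rewrite mulrCA -Ep mulr_sumr; apply: eq_bigr => a _.
  by rewrite -/K Ksym; ring.
have [c gx] := perron_simple Ksym K0 Ksupp Kirr mu0 Ep p0 sa0 (eigen_grad _ _ Lx).
have [w wlt] := increasing_exists.
have wx : 0 < \sum_j w j * x j.
  rewrite adj (bigD1 a0) //= ltr_pwDl //.
    by rewrite mulr_gt0 ?p0 // /grad sa0 mul1r subr_gt0 wlt.
  apply: sumr_ge0 => a _; have [Oa|nOa] := boolP (O a); last by rewrite psupp ?mulr0.
  by rewrite mulr_ge0 ?(ltW (p0 _ Oa)) // /grad (Oa : s a.1 a.2) mul1r subr_ge0 ltW ?wlt.
have xx : 0 < \sum_j x j * x j.
  rewrite lt_def sumr_ge0 ?andbT; last by move=> j _; rewrite -expr2 sqr_ge0.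
  apply: contraTneq wx => xx0; rewrite big1 ?ltxx // => j _.
  have := psumr_eq0P (fun j _ => sqr_ge0 (x j)) xx0 (i := j) isT.
  by move=> /eqP; rewrite sqrf_eq0 => /eqP->; rewrite mulr0.
(* By [adj] and [gx], the positive sum of squares of x is c times the sum of squares of p. *)
have c0 : 0 < c.
  rewrite ltNge; apply: contraTN xx => cle; rewrite -leNgt adj.
  apply: sumr_le0 => a _; rewrite gx -mulrA -expr2.
  by rewrite mulr_le0_ge0 ?sqr_ge0.
exists mu, x; split=> // [i j sij|la z Lz [j zj]|z Lz].
- have := gx (i, j); rewrite /grad /= sij mul1r => xij.
  by rewrite -subr_gt0 xij mulr_gt0 ?p0.
- have [gz|] := pselect (forall a, grad s z a = 0).
    have /eqP := grad_eq0_eigen gz Lz j; rewrite mulf_eq0 (negPf zj) orbF => /eqP->.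
    exact: ltW.
  move=> /existsNP[a /eqP ga].
  apply: (perron_max Ksym K0 Ksupp mu0 Ep p0 (eigen_grad _ _ Lz)).
  exists a => //; apply: contraNT ga => nOa.
  by rewrite /grad (negPf nOa : s a.1 a.2 = false) mul0r.
have [d gz] := perron_simple Ksym K0 Ksupp Kirr mu0 Ep p0 sa0 (eigen_grad _ _ Lz).
(* The gradients of z and x are d p and c p, so [y] has zero gradient and stays an eigenfunction for
   mu, which is nonzero; hence y = 0. *)
exists (d / c) => j; pose y k := z k - d / c * x k.
have gy a : grad s y a = 0.
  have -> : grad s y a = grad s z a - d / c * grad s x a by rewrite /grad /y; ring.
  by rewrite gz gx; field; rewrite gt_eqF.
have Ly k : lap e y k = mu * y k.
  have -> : lap e y k = lap e z k - d / c * lap e x k.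
    by rewrite /lap mulr_sumr -sumrB; apply: eq_bigr => l _; rewrite /y; ring.
  by rewrite Lz Lx /y; ring.
have /eqP := grad_eq0_eigen gy Ly j.
by rewrite mulf_eq0 gt_eqF //= subr_eq0 => /eqP.
Qed.

End Spectrum.

(** * Transfer to matrices, eigenspaces and induced orientations *)

Section MatrixForm.
Variables (R : realType) (n : nat) (e : rel 'I_n).

Lemma mul_laplacian (x : 'rV[R]_n) (j : 'I_n) : simple_graph e ->
  (x *m laplacian R e) 0 j = lap e (x 0) j.
Proof.
move=> [esym eirr]; have degE : (deg e j)%:R = \sum_k (e j k)%:R :> R.
  rewrite -natr_sum /deg -sum1_card big_mkcond /=; congr (_%:R).
  apply: eq_bigr => k _; rewrite inE finset.in_set1.
  have -> : [exists i in [set j]%SET, e i k] = e j k.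
    apply/existsP/idP => [[i]|jk]; first by rewrite finset.in_set1 => /andP[/eqP->].
    by exists j; rewrite finset.in_set1 eqxx.
  by have [->|] := eqVneq k j; rewrite ?eirr //; case: (e j k).
rewrite mxE /lap; under [RHS]eq_bigr do rewrite mulrBr.
rewrite sumrB -mulr_suml -degE (bigD1 j) //= mxE eqxx mulrC; congr (_ + _).
rewrite [in RHS](bigD1 j) //= eirr mul0r add0r -sumrN; apply: eq_bigr => k kj.
by rewrite mxE (negPf kj) esym; case: (e j k) => /=; ring.
Qed.

Lemma eigen_laplacianP (a : R) (x : 'rV[R]_n) : simple_graph e ->
  x *m laplacian R e = a *: x <-> forall j, lap e (x 0) j = a * x 0 j.
Proof.
move=> simp; split=> [H j|H]; first by rewrite -mul_laplacian // H mxE.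
by apply/rowP => j; rewrite mul_laplacian // mxE.
Qed.

Lemma lambda_maxE (M : 'M[R]_n) (mu : R) :
  eigenvalue M mu -> (forall a, eigenvalue M a -> a <= mu) -> lambda_max M = mu.
Proof.
move=> Mmu Mle; apply/le_anti/andP; split; first by apply: ge_sup => //; exists mu.
by apply: ub_le_sup => //; exists mu.
Qed.

Lemma rank_line (M : 'M[R]_n) (x : 'rV[R]_n) : x != 0 -> (x <= M)%MS ->
  (forall z : 'rV[R]_n, (z <= M)%MS -> exists c, z = c *: x) -> \rank M = 1%N.
Proof.
move=> x0 xM Mx; have rx : \rank x = 1%N by rewrite rank_rV x0.
apply/eqP; rewrite eqn_leq -{2}rx (mxrankS xM) andbT -rx mxrankS //.
apply/row_subP => i; have [c ->] := Mx _ (row_sub i M).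
exact: scalemx_sub.
Qed.

Lemma induced_arcs_increasing (s : rel 'I_n) (x : 'rV[R]_n) :
  orders_edges e s -> (forall i j, s i j -> x 0 i < x 0 j) ->
  arc_rel (induced_arcs e x) = s.
Proof.
move=> [_ _ sE] xs; apply/funext => i; apply/funext => j.
rewrite /arc_rel inE /= sE; apply/andP/idP => [[/orP[//|/xs ji]]|ij].
  by move=> /(lt_trans ji); rewrite ltxx.
by rewrite ij xs.
Qed.

Lemma induced_arcs_scale (c : R) (x : 'rV[R]_n) : c != 0 ->
  induced_arcs e (c *: x) = induced_arcs e x \/
  induced_arcs e (c *: x) = induced_arcs e (- x).
Proof.
rewrite neq_lt => /orP[c0|c0]; [right|left]; apply/setP => -[i j].
  by rewrite !inE !mxE /= ltr_nM2l // ltrN2.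
by rewrite !inE !mxE /= ltr_pM2l.
Qed.

Lemma induced_arcs_transitive (s : rel 'I_n) (x : 'rV[R]_n) :
  simple_graph e -> orders_edges e s -> (forall i j, s i j -> x 0 i < x 0 j) ->
  transitive_orientation e (induced_arcs e x) /\
  transitive_orientation e (induced_arcs e (- x)).
Proof.
move=> [_ eirr] sO xs; split; apply/(transitive_orientationP _ eirr).
  by rewrite (induced_arcs_increasing sO xs).
have rO := orders_edges_rev sO.
by rewrite (induced_arcs_increasing rO) // => i j ji; rewrite !mxE ltrN2 xs.
Qed.

Hypotheses (simple_e : simple_graph e) (connected_e : connected_graph e).
Hypothesis no_module : ~ exists A : {set 'I_n},
  [/\ is_module e A, A <> [set: 'I_n]%SET, (1 < #|A|)%N & connected_on e A].

(** The eigenvalue of [laplacian_perron] is attained and bounds all others, so it is [lambda_max].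
    As [Emax] does not depend on [s], two orientations can be compared within one line. *)
Lemma Emax_increasing (s : rel 'I_n) (a : 'I_n * 'I_n) :
  orders_edges e s -> s a.1 a.2 ->
  exists x : 'rV[R]_n, [/\ (x <= Emax R e)%MS, x != 0,
    (forall i j, s i j -> x 0 i < x 0 j) &
    (forall z : 'rV[R]_n, (z <= Emax R e)%MS -> exists c, z = c *: x)].
Proof.
move=> sO sa.
have [mu [x [mu0 Lx xs mumax musimple]]] :=
  laplacian_perron R simple_e connected_e no_module sO sa.
pose X : 'rV[R]_n := \row_j x j.
have XE : X 0 = x by apply/funext => j; rewrite mxE.
have X0 : X != 0.
  apply/eqP => X0; have := xs _ _ sa; rewrite -XE X0 !mxE.
  by rewrite ltxx.
have LX : X *m laplacian R e = mu *: X.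
  by apply/(eigen_laplacianP _ _ simple_e); rewrite XE.
have lmax : lambda_max (laplacian R e) = mu.
  apply: lambda_maxE => [|la /eigenvalueP[z Lz z0]].
    by apply/eigenvalueP; exists X.
  apply: (mumax _ (z 0)); first exact/(eigen_laplacianP _ _ simple_e).
  apply: contrapT => /forallNP zz; case/eqP: z0; apply/rowP => j.
  by rewrite mxE; have /negP/negPn/eqP := zz j.
exists X; split=> //; first by rewrite /Emax lmax; apply/eigenspaceP.
  by move=> i j sij; rewrite !XE xs.
rewrite /Emax lmax => z /eigenspaceP /(eigen_laplacianP _ _ simple_e)/musimple[c zc].
by exists c; apply/rowP => j; rewrite !mxE.
Qed.

End MatrixForm.

(** * The one-vertex graph and the conclusion *)

Lemma one_vertex_Emax (R : realType) (e : rel 'I_1) :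
  irreflexive e -> \rank (Emax R e) = 1%N.
Proof.
move=> eirr; have L0 : laplacian R e = 0.
  apply/matrixP => i j; rewrite !mxE !ord1 eqxx /deg.
  suff -> : nbhd e [set ord0]%SET = finset.set0 by rewrite cards0.
  by apply/setP => k; rewrite !inE ord1 eqxx.
rewrite /Emax L0 (@lambda_maxE _ _ _ 0).
- by rewrite /eigenspace sub0r raddf0 oppr0 mxrank_ker mxrank0.
- apply/eigenvalueP; exists (const_mx 1); first by rewrite mulmx0 scale0r.
  by apply/eqP => /rowP/(_ ord0); rewrite !mxE => /eqP; rewrite oner_eq0.
move=> a /eigenvalueP[v]; rewrite mulmx0 => /esym/eqP.
by rewrite scaler_eq0 => /orP[/eqP->//|->].
Qed.

Theorem theorem3p5 (R : realType) (n : nat) (e : rel 'I_n)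
    (simple_e : simple_graph e)
    (connected_e : connected_graph e)
    (comparability_e : comparability_graph e)
    (no_module : ~ exists A : {set 'I_n},
       [/\ is_module e A, A <> [set: 'I_n]%SET, (1 < #|A|)%N & connected_on e A]) :
  [/\ (forall x : 'rV[R]_n, (x <= Emax R e)%MS -> x != 0 ->
         transitive_orientation e (induced_arcs e x)),
      \rank (Emax R e) = 1%N &
      ((1 < n)%N ->
       exists O1 O2 : arcs n, O1 <> O2 /\
         forall O : arcs n,
           transitive_orientation e O <-> (O = O1 \/ O = O2))].
Proof.
have eirr := simple_e.2.
have [s sO] := comparability_orders_edges comparability_e.
have [irr tr sE] := sO.
(* A single vertex has no arc to start the Perron argument, and its only transitive orientation is
   the empty one, whence the guard 1 < n on the count; n = 0 is excluded by connectedness. *)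
have [n1|n1] := leqP n 1.
  have n_eq1 : n = 1%N.
    apply/eqP; rewrite eqn_leq n1 lt0n; apply/eqP => n0; case: connected_e => + _.
    by apply; apply/setP => i; move: (ltn_ord i); rewrite {2}n0.
  subst n; split=> //; last exact: one_vertex_Emax.
  move=> x _ _; apply/(transitive_orientationP _ eirr).
  rewrite (induced_arcs_increasing sO) // => i j.
  by rewrite !ord1 irr.
(* Without arcs, connectedness would make every function constant, yet the indicator of [i0]
   separates two vertices. *)
have [[i j] /= sij] : exists a : 'I_n * 'I_n, s a.1 a.2.
  apply: contrapT => /forallNP noarc.
  pose i0 : 'I_n := Ordinal (ltnW n1); pose i1 : 'I_n := Ordinal n1.
  have := connected_constant (R := R) connected_e sO (z := fun k => (k == i0)%:R).
  have sz i j : s i j -> (i == i0)%:R = (j == i0)%:R :> R.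
    by move=> sij; case: (noarc (i, j)).
  by move=> /(_ sz i1 i0)/eqP; rewrite eqxx eq_sym oner_eq0.
have [x [xE x0 xs xline]] :=
  Emax_increasing R simple_e connected_e no_module sO (a := (i, j)) sij.
have [T1 T2] := induced_arcs_transitive simple_e sO xs.
split=> [z /xline[c ->]||_].
- rewrite scaler_eq0 negb_or => /andP[c0 _].
  by have [->|->] := induced_arcs_scale e x c0.
- exact: rank_line x0 xE xline.
exists (induced_arcs e x), (induced_arcs e (- x)); split.
  move/setP/(_ (i, j)); rewrite !inE /= sE sij !mxE ltrN2 xs //.
  by rewrite ltNge (ltW (xs _ _ sij)).
move=> O; split=> [tO|[->|->]//].
have oO := (transitive_orientationP O eirr).1 tO.
have [a Oa] : exists a : 'I_n * 'I_n, arc_rel O a.1 a.2.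
  case: (oO) => _ _ /(_ i j); rewrite sE sij => /esym/orP[ij|ji].
    by exists (i, j).
  by exists (j, i).
(* [O] is recovered from its own increasing vector y, a nonzero multiple of x; the sign of the
   factor decides between the two orientations. *)
have [y [yE y0 ys _]] := Emax_increasing R simple_e connected_e no_module oO Oa.
have OE : O = induced_arcs e y.
  have E := induced_arcs_increasing oO ys.
  by apply/setP => -[k l]; have := congr1 (fun r => r k l) E.
have [c yc] := xline _ yE; rewrite OE yc; apply: induced_arcs_scale.
by apply: contraNneq y0 => c0; rewrite yc c0 scale0r.
Qed.
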